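(* Let $p=p(n)\in(0,1)$ be a real sequence, $h=h(n)$ an integer sequence, $N=\binom n2$, and for each $n$ let $\mathscr S=\mathscr S(n)$ be a set of labelled graphs on the vertex set $[n]$, each having exactly $h$ edges. Let $X_n$ be the number of members of $\mathscr S$ contained in the random graph on $[n]$ under consideration. Assume $h^3=o(p^2n^4)$. Let $\beta_n=h\sqrt{(1-p)/(pN)}$ and $\lambda_n=|\mathscr S|p^h$. Assume further that $\liminf_{n\to\infty}\beta_n>0$. If for all $m=pN+O(\sqrt{pN})$ we have $X_n/\mathbf E_{\mathcal G(n,m)}(X_n)\xrightarrow{p}1$ in $\mathcal G(n,m)$, then in $\mathcal G(n,p)$ $$\frac{\ln\bigl(e^{\beta_n^2/2}X_n/\lambda_n\bigr)}{\beta_n}\xrightarrow{d}\mathcal N(0,1)\quad\text{as } n\to\infty.$$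
   Context: $\mathcal G(n,m)$ is the uniformly random graph on vertex set $[n]$ with exactly $m$ edges; $\mathcal G(n,p)$ is the binomial random graph on $[n]$ in which each edge is present independently with probability $p$. All asymptotics are as $n\to\infty$. ''For all $m=pN+O(\sqrt{pN})$'' means for every integer sequence $m=m(n)$ with $|m-pN|=O(\sqrt{pN})$. $\mathcal N(0,1)$ is the standard normal distribution; $\xrightarrow{p}$ and $\xrightarrow{d}$ denote convergence in probability and in distribution. *)

(* Defs.v *)
From mathcomp Require Import all_boot all_order all_algebra.
From mathcomp Require Import all_classical all_reals all_analysis.

Set Implicit Arguments.
Unset Strict Implicit.
Unset Printing Implicit Defensive.

Import Order.TTheory GRing.Theory Num.Theory.
Import numFieldNormedType.Exports.

Local Open Scope classical_set_scope.
Local Open Scope ring_scope.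

(* A graph on the labelled vertex set 'I_n is identified with its set of edges,
   an edge being a 2-element set of vertices; hence every element of
   {set edge n} is a simple graph, #|G| is its number of edges, and
   \subset is containment of labelled graphs. *)
Definition edge (n : nat) : finType := {e : {set 'I_n} | #|e| == 2%N}.

Definition graph (n : nat) : finType := {set edge n}.

(* Probability and expectation on a finite space T whose law is given by its
   mass function mu. *)
Definition Pr (R : realType) (T : finType) (mu : T -> R) (A : pred T) : R :=
  \sum_(w | A w) mu w.

Definition Ex (R : realType) (T : finType) (mu : T -> R) (Y : T -> R) : R :=
  \sum_w mu w * Y w.

Definition gnm (R : realType) (n m : nat) (G : graph n) : R :=
  if #|G| == m then #|[pred H : graph n | #|H| == m]|%:R^-1 else 0.

Definition gnp (R : realType) (n : nat) (p : R) (G : graph n) : R :=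
  \prod_(e : edge n) (if e \in G then p else 1 - p).

Definition ncopies (n : nat) (S : {set graph n}) (G : graph n) : nat :=
  #|[pred H in S | H \subset G]|.

(* The n-th random variable Y n lives on its own finite space (T n, mu n). *)
Definition cvg_in_prob (R : realType) (T : nat -> finType)
    (mu : forall n, T n -> R) (Y : forall n, T n -> R) (c : R) : Prop :=
  forall eps : R, 0 < eps ->
    Pr (mu n) (fun w => eps < `|Y n w - c|) @[n --> \oo] --> (0 : R).

(* The Y n are allowed to take infinite values; the limit law nu is a
   probability measure on the real line. *)
Definition cvg_in_distr (R : realType) (T : nat -> finType)
    (mu : forall n, T n -> R) (Y : forall n, T n -> \bar R)
    (nu : probability (measurableTypeR R) R) : Prop :=
  forall t : R, {for t, continuous (fun s : R => nu `]-oo, s]%classic)} ->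
    (Pr (mu n) (fun w => (Y n w <= t%:E)%E))%:E @[n --> \oo] --> nu `]-oo, t]%classic.

Definition nedges (R : realType) (n : nat) : R := 'C(n, 2)%:R.

Definition beta (R : realType) (p : nat -> R) (h : nat -> nat) (n : nat) : R :=
  (h n)%:R * Num.sqrt ((1 - p n) / (p n * nedges R n)).

Definition lambda (R : realType) (p : nat -> R) (h : nat -> nat)
    (S : forall n, {set graph n}) (n : nat) : R :=
  #|S n|%:R * p n ^+ h n.

(* ln (e ^ (beta^2 / 2) X / lambda) / beta, with the extended logarithm, so that
   the value is -oo (rather than 0) on the event X = 0. *)
Definition log_count (R : realType) (p : nat -> R) (h : nat -> nat)
    (S : forall n, {set graph n}) (n : nat) (G : graph n) : \bar R :=
  (lne (expR (beta p h n ^+ 2 / 2) * (ncopies (S n) G)%:R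
        / lambda p h S n)%:E / (beta p h n)%:E)%E.

(* Main.v *)
Require Import Defs.
From mathcomp Require Import all_boot all_order all_algebra.
From mathcomp Require Import all_classical all_reals all_analysis.
From mathcomp Require Import measurable_realfun zify ring lra.

Set Implicit Arguments.
Unset Strict Implicit.
Unset Printing Implicit Defensive.

Import Order.TTheory GRing.Theory Num.Theory.
Import numFieldNormedType.Exports.

Local Open Scope classical_set_scope.
Local Open Scope ring_scope.

(** Write a = pN for the mean and s = sqrt(Np(1-p)) for the standard deviation
    of the number M of edges of G(n,p), X for the number of copies and E_m for
    its mean in G(n,m).

    All the fluctuation of X comes from M.  Given M = m the graph is G(n,m), in
    which X is close to E_m by hypothesis, and E_m is explicit:
    E_m = |S| times the product over i < h of (m - i) / (N - i)
    ([Ex_ncopies]).  Expanding the logarithm of each factor, with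
    d = (m - a) / a, gives
      ln (E_m / lambda) = h d - beta^2 / 2 + O(h d^2 + h^3 / a^2 + h / a)
    ([falling_product]), where h d = beta (m - a) / s.  Hence, when X is close
    to E_M, the normalised logarithm of X is (M - a) / s up to an error divided
    by beta, and beta is bounded away from 0 ([log_count_close]).  So the
    theorem follows from the central limit theorem for the binomial variable M,
    once the error terms are small and s tends to infinity; the conditions
    h^3 = o(a^2) and beta >= c give both ([scales_small]).

    The hypothesis on G(n,m) is about one sequence m(n) at a time, whereas M
    ranges over a whole window |m - a| <= K s.  Applying it to a sequence that
    picks, for each n, an m in the window for which X is badly concentrated, if
    there is one, makes it uniform over the window.

    The central limit theorem for binomial variables whose parameter varies
    with N ([de_moivre_laplace]) is proved by comparing two measures.  The ratio
    of consecutive binomial weights is exp(- x_k / s + O(1 / s^2)), with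
    x_k = (k - a) / s, which is up to O(1 / s^2) the ratio of consecutive values
    of exp(- x^2 / 2) at the points x_k.  Over the at most 2 K s steps of the
    window these errors add up to O(1 / s), so there the binomial weights are
    proportional to the normal masses of the cells ]x_k, x_(k+1)], up to a
    factor that tends to 1.  Both measures give mass close to 1 to the window,
    the binomial one by Chebyshev's inequality, and this fixes the constant of
    proportionality; Stirling's formula is not needed. *)

(** * Binomial weights and Chebyshev's inequality *)

Lemma binomial_pmfE {R : realType} (N : nat) (P : R) (k : nat) :
  binomial_pmf N P k = P ^+ k * (1 - P) ^+ (N - k) *+ 'C(N, k).
Proof. by []. Qed.

Lemma binomial_pmf_pascal {R : realType} (N : nat) (P : R) (k : nat) :
  binomial_pmf N.+1 P k.+1 =
  P * binomial_pmf N P k + (1 - P) * binomial_pmf N P k.+1.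
Proof.
rewrite !binomial_pmfE subSS binS mulrnDr addrC !mulrnAr; congr (_ + _).
  by rewrite exprS -mulrA.
have [kN|Nk] := ltnP k N; last by rewrite bin_small// !mulr0n.
by rewrite -(subnSK kN) !exprS; congr (_ *+ _); ring.
Qed.

(** Conditioning on the last trial; the moments below follow by induction on
    the number of trials. *)
Lemma binomial_sum_recr {R : realType} (N : nat) (P : R) (f : nat -> R) :
  \sum_(k < N.+2) binomial_pmf N.+1 P k * f k =
  (1 - P) * (\sum_(k < N.+1) binomial_pmf N P k * f k) +
  P * (\sum_(k < N.+1) binomial_pmf N P k * f k.+1).
Proof.
rewrite big_ord_recl/=.
under eq_bigr do rewrite /bump/= add1n binomial_pmf_pascal mulrDl -!mulrA.
rewrite big_split/= -!mulr_sumr [X in _ + (_ + _ * X)]big_ord_recr/=.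
rewrite (binomial_pmfE N P N.+1) bin_small// mulr0n mul0r addr0.
rewrite [X in _ = (1 - P) * X + _]big_ord_recl/= mulrDr.
rewrite !binomial_pmfE !bin0 !subn0 !expr0 !mul1r !mulr1n exprS.
by under [X in _ = _ + (1 - P) * X + _]eq_bigr do rewrite /bump/= add1n; ring.
Qed.

Lemma binomial_sum1 {R : realType} (N : nat) (P : R) :
  \sum_(k < N.+1) binomial_pmf N P k = 1.
Proof.
under eq_bigr do rewrite binomial_pmfE mulrC.
by rewrite -exprDn subrK expr1n.
Qed.

(** The moment is taken about an arbitrary point because the induction moves
    that point by 1. *)
Lemma binomial_second_moment {R : realType} (N : nat) (P a : R) :
  \sum_(k < N.+1) binomial_pmf N P k * (k%:R - a) ^+ 2 =
  N%:R * P * (1 - P) + (P * N%:R - a) ^+ 2.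
Proof.
elim: N a => [|N IH] a.
  by rewrite big_ord1 binomial_pmfE bin0 subn0 !expr0 mulr1 mulr1n /=; ring.
rewrite (binomial_sum_recr _ _ (fun k => (k%:R - a) ^+ 2)) IH.
under [X in _ + P * X]eq_bigr => k _.
  rewrite (_ : k.+1%:R - a = k%:R - (a - 1)); last by rewrite -natr1; ring.
  over.
by rewrite IH -natr1; ring.
Qed.

Lemma binomial_chebyshev {R : realType} (N : nat) (P t : R) :
  0 <= P <= 1 -> 0 <= t ->
  t ^+ 2 * (\sum_(k < N.+1 | t < `|k%:R - P * N%:R|) binomial_pmf N P k)
    <= N%:R * P * (1 - P).
Proof.
move=> P01 t0; rewrite mulr_sumr.
have := binomial_second_moment N P (P * N%:R).
rewrite subrr expr0n/= addr0 => <-.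
rewrite big_mkcond/=; apply: ler_sum => k _.
have b0 := binomial_pmf_ge0 N k P01.
case: ifPn => tk; last by rewrite mulr_ge0// sqr_ge0.
rewrite mulrC ler_wpM2l// -(real_normK (num_real (_ - _))).
by rewrite lerXn2r// ?nnegrE// ltW.
Qed.

(** * The standard normal distribution function *)

Definition Phi {R : realType} (x : R) : R :=
  fine (normal_prob 0 1 `]-oo, x]%classic : \bar R).

Lemma EFin_Phi {R : realType} (x : R) :
  (Phi x)%:E = normal_prob 0 1 `]-oo, x]%classic.
Proof. by rewrite /Phi fineK// fin_num_measure. Qed.

Lemma Phi_ge0 {R : realType} (x : R) : 0 <= Phi x.
Proof. by rewrite -lee_fin EFin_Phi. Qed.

Lemma Phi_le1 {R : realType} (x : R) : Phi x <= 1.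
Proof. by rewrite -lee_fin EFin_Phi probability_le1. Qed.

Lemma EFin_PhiB {R : realType} (x y : R) : x <= y ->
  (Phi y - Phi x)%:E = normal_prob 0 1 `]x, y]%classic.
Proof.
move=> xy; rewrite EFinB !EFin_Phi.
have -> : `]x, y]%classic = `]-oo, y] `\` `]-oo, x] :> set R.
  by rewrite -[RHS]setCK setCD setCitvl setUC -[LHS]setCK setCitv.
rewrite measureD// ?setIidr//; first exact: subset_itvl.
by rewrite -ge0_fin_numE// fin_num_measure.
Qed.

Lemma Phi_nondecreasing {R : realType} (x y : R) : x <= y -> Phi x <= Phi y.
Proof. by move=> xy; rewrite -subr_ge0 -lee_fin EFin_PhiB. Qed.

Lemma PhiB_ge {R : realType} (x y c : R) : x <= y -> 0 <= c ->
  (forall z, x < z <= y -> c <= normal_pdf 0 1 z) ->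
  c * (y - x) <= Phi y - Phi x.
Proof.
move=> xy c0 h; rewrite -lee_fin EFin_PhiB// /normal_prob.
have -> : ((c * (y - x))%:E = \int[lebesgue_measure]_(z in `]x, y]) c%:E :> \bar R)%E.
  rewrite integral_cst//= lebesgue_measure_itv/= lte_fin EFinM.
  by case: ltgtP xy => // -> _; rewrite subrr !mule0.
apply: ge0_le_integral => //=.
  by apply/measurable_EFinP; apply: measurable_funTS; exact: measurable_normal_pdf.
Qed.

Lemma PhiB_le {R : realType} (x y c : R) : x <= y -> 
  (forall z, x < z <= y -> normal_pdf 0 1 z <= c) ->
  Phi y - Phi x <= c * (y - x).
Proof.
move=> xy h; rewrite -lee_fin EFin_PhiB// /normal_prob.
have [xy'|yx] := ltP x y; last first.
  have -> : y = x by lra.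
  by rewrite set_itv_ge ?bnd_simp ?ltxx// integral_set0 subrr mulr0.
have -> : ((c * (y - x))%:E = \int[lebesgue_measure]_(z in `]x, y]) c%:E :> \bar R)%E.
  by rewrite integral_cst//= lebesgue_measure_itv/= lte_fin EFinM xy'.
have c0 : 0 <= c.
  by apply: le_trans (h y _); rewrite ?normal_pdf_ge0// xy' lexx.
apply: ge0_le_integral => //=.
- by move=> z _; rewrite lee_fin normal_pdf_ge0.
- by apply/measurable_EFinP; apply: measurable_funTS; exact: measurable_normal_pdf.
Qed.

Lemma std_normal_pdfE {R : realType} (x : R) :
  normal_pdf 0 1 x = normal_peak 1 * expR (- x ^+ 2 / 2).
Proof. by rewrite normal_pdfE ?oner_neq0// /normal_fun subr0 expr1n. Qed.

Lemma normal_peak1_le1 {R : realType} : normal_peak (1 : R) <= 1.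
Proof.
rewrite /normal_peak invf_le1 ?sqrtr_gt0 ?expr1n ?mul1r; last first.
  by rewrite mulrn_wgt0// pi_gt0.
rewrite -[leLHS]sqrtr1 ler_sqrt; last by rewrite mulrn_wge0// pi_ge0.
by have := pi_ge2 R; lra.
Qed.

Lemma Phi_lipschitz {R : realType} (x y : R) : x <= y -> Phi y - Phi x <= y - x.
Proof.
move=> xy; rewrite -[leRHS]mul1r; apply: PhiB_le => // z _.
by rewrite (le_trans (normal_pdf_ub _ _ _))// ?oner_neq0// normal_peak1_le1.
Qed.

(** The exponent x^2 / 2 varies by at most L (y - x) between x and y when both
    lie in [-L, L], so the mass of ]x, y] is the density at the left end point
    times the length, up to that exponential factor. *)
Lemma PhiB_local {R : realType} (L x y : R) : x <= y -> - L <= x -> y <= L ->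
  normal_peak 1 * expR (- x ^+ 2 / 2 - L * (y - x)) * (y - x) <= Phi y - Phi x
    <= normal_peak 1 * expR (- x ^+ 2 / 2 + L * (y - x)) * (y - x).
Proof.
move=> xy Lx yL; apply/andP; split.
- apply: PhiB_ge => //; first by rewrite mulr_ge0 ?normal_peak_ge0 ?expR_ge0.
  move=> z /andP[xz zy]; rewrite std_normal_pdfE ler_wpM2l ?normal_peak_ge0//.
  by rewrite ler_expR; nra.
- apply: PhiB_le => // z /andP[xz zy].
  by rewrite std_normal_pdfE ler_wpM2l ?normal_peak_ge0// ler_expR; nra.
Qed.

Lemma Phi_tails {R : realType} (eps : R) : 0 < eps ->
  exists2 K, 0 < K & forall x, K <= x -> 1 - eps <= Phi x /\ Phi (- x) <= eps.
Proof.
move=> e0.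
have cvg1 : normal_prob 0 1 `]- n%:R, (n%:R : R)]%classic @[n --> \oo] -->
    (normal_prob 0 1 (\bigcup_n `](- n%:R : R), n%:R]%classic) : \bar R).
  apply: nondecreasing_cvg_mu => //; first exact: bigcup_measurable.
  move=> i j ij; apply/subsetPset/subset_itv; rewrite bnd_simp ?lerN2 ler_nat//.
rewrite (_ : \bigcup_n _ = setT) ?probability_setT in cvg1; last first.
  apply/seteqP; split=> // x _.
  exists (Num.truncn `|x|).+1 => //=; rewrite in_itv/=.
  have x1 : `|x| < (Num.truncn `|x|).+1%:R by exact: truncnS_gt.
  by move: x1; rewrite ltr_norml => /andP[-> /ltW].
have [n _ /(_ n (leqnn n))] :
    \forall n \near \oo, 1 - eps < fine (normal_prob 0 1 `]- n%:R, (n%:R : R)]%classic).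
  by apply: cvgr_gt (fine_cvg cvg1) _ _; rewrite ltrBlDr ltrDl.
rewrite -EFin_PhiB/= ?ge0_cp// => epsn.
exists n.+1%:R => // x nx.
have nx' : n%:R <= x by apply: le_trans nx; rewrite ler_nat.
have nx'' : - x <= - n%:R by rewrite lerN2.
have := Phi_nondecreasing nx'; have := Phi_nondecreasing nx''.
have := Phi_ge0 (- n%:R : R); have := Phi_le1 (n%:R : R).
lra.
Qed.

(** * Binomial weights compared with normal masses *)

(** From exp z >= 1 + z at z = - y + 2 y^2: the product
    (1 + y) (1 - y + 2 y^2) = 1 + y^2 (1 + 2 y) is at least 1. *)
Lemma expR_le1D {R : realType} (y : R) : - 2^-1 <= y ->
  expR (y - 2 * y ^+ 2) <= 1 + y.
Proof.
move=> y2.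
have y1 : 0 < 1 + y by lra.
rewrite -[y - _]opprK expRN invf_ple ?posrE ?expR_gt0//.
have := @expR_ge1Dx R (- (y - 2 * y ^+ 2)); apply: le_trans.
rewrite -[leLHS]mul1r ler_pdivrMr//.
have : 0 <= y ^+ 2 * (1 + 2 * y) by rewrite mulr_ge0 ?sqr_ge0//; lra.
nra.
Qed.

(** Multiplying both sides by exp(v - t); this form lets linear arithmetic deal
    with the exponents. *)
Lemma expR_shift_le {R : realType} (A B t u v w : R) : 0 <= B ->
  A * expR t <= B * expR u -> v + u - t <= w -> A * expR v <= B * expR w.
Proof.
move=> B0 AB vw.
rewrite -(ler_pM2r (expR_gt0 (v - t))) -!mulrA -!expRD in AB.
rewrite (_ : t + (v - t) = v) in AB; last by ring.
by apply: le_trans AB _; rewrite ler_wpM2l// ler_expR; lra.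
Qed.

Definition standardize {R : realType} (c s : R) (k : nat) : R := (k%:R - c) / s.

(** Points in the window |x k| <= K are compared.  The condition on s makes all
    the perturbations 1 + y of the ratios of consecutive weights satisfy
    |y| <= 1/2. *)
Section local_limit.
Variables (R : realType) (N : nat) (P s K : R).
Hypotheses (P01 : 0 < P < 1) (K1 : 1 <= K) (s2E : s ^+ 2 = N%:R * P * (1 - P)).
Local Notation x := (standardize (P * N%:R) s).
Local Notation b := (binomial_pmf N P).
Local Notation L := (K + 1).
Hypothesis sL : 2 * L <= s.

Lemma window_sd_gt0 : 0 < s. Proof. by move: K1 sL; lra. Qed.

Lemma standardizeS k : x k.+1 = x k + s^-1.
Proof. by rewrite /standardize -natr1; ring. Qed.

Lemma standardizeK k : k%:R = P * N%:R + x k * s.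
Proof. by rewrite /standardize divfK ?gt_eqF ?window_sd_gt0//; ring. Qed.

(** The window lies below the number of trials, since
    K s < s^2 <= N (1 - P). *)
Lemma window_lt k : x k <= K -> (k < N)%N.
Proof.
move=> xk; rewrite -(ltr_nat R) (standardizeK k).
have s0 := window_sd_gt0; have sE := s2E; case/andP: P01 => P0 P1.
have K1' := K1; have sL' := sL.
have : x k * s <= K * s by rewrite ler_wpM2r// ltW.
have : K * s < s * s by rewrite ltr_pM2r//; lra.
have : N%:R * P * (1 - P) <= N%:R * (1 - P) by rewrite -mulrA ler_wpM2l// ler_piMl; lra.
rewrite -expr2; lra.
Qed.

Lemma binomial_pmf_gt0 k : (k <= N)%N -> 0 < b k.
Proof.
move=> kN; case/andP: P01 => P0 P1.
by rewrite binomial_pmfE mulrn_wgt0 ?bin_gt0// mulr_gt0 ?exprn_gt0//; lra.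
Qed.

Lemma binomial_pmfS k : (k < N)%N ->
  b k.+1 * (k.+1%:R * (1 - P)) = b k * ((N%:R - k%:R) * P).
Proof.
move=> kN; rewrite !binomial_pmfE -[in (N - k)%N](subnSK kN) !exprS.
have : (k.+1%:R * 'C(N, k.+1)%:R = (N%:R - k%:R) * 'C(N, k)%:R :> R).
  by rewrite -natrB 1?ltnW// -!natrM mul_bin_left.
move=> h; rewrite -(mulr_natr _ 'C(N, k.+1)) -(mulr_natr _ 'C(N, k)).
transitivity (P * P ^+ k * (1 - P) ^+ (N - k.+1) * (1 - P) *
   (k.+1%:R * 'C(N, k.+1)%:R)); first by ring.
by rewrite h; ring.
Qed.

(** The ratio ((N - k) P) / ((k + 1) (1 - P)) of consecutive weights, with
    numerator and denominator divided by s^2 = N P (1 - P). *)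
Lemma binomial_pmf_ratio k : `|x k| <= K ->
  b k.+1 * (1 + (x k * (1 - P) / s + (1 - P) / s ^+ 2)) = b k * (1 - x k * P / s).
Proof.
move=> xk; have s0 := window_sd_gt0; have sE := s2E; case/andP: P01 => P0 P1.
have kN : (k < N)%N by apply: window_lt; move: xk; rewrite ler_norml => /andP[].
have := binomial_pmfS kN; rewrite -natr1 (standardizeK k) => h.
have sn : s != 0 by rewrite gt_eqF.
apply: (mulIf (expf_neq0 2 sn)); rewrite -[LHS]mulrA -[RHS]mulrA.
transitivity (b k.+1 * ((P * N%:R + x k * s + 1) * (1 - P))).
  congr (_ * _); transitivity (s ^+ 2 + x k * s * (1 - P) + (1 - P)); first by field.
  by rewrite sE; ring.
rewrite h; congr (_ * _); transitivity (s ^+ 2 - x k * s * P); last by field.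
by rewrite sE; ring.
Qed.

Definition gauss_weight (z : R) := expR (- z ^+ 2 / 2).

(** With u = x P / s and v = x (1 - P) / s + (1 - P) / s^2 the ratio of
    consecutive binomial weights is (1 - u) / (1 + v), hence exp(- u - v) up to
    quadratic terms, and u + v = x / s + (1 - P) / s^2.  The ratio of
    consecutive Gaussian weights is exp(- x / s - 1 / (2 s^2)), so only terms
    of order 1 / s^2 remain. *)
Lemma binomial_gauss_step k : `|x k| <= K ->
  b k.+1 * gauss_weight (x k) <=
    expR (3 * L ^+ 2 / s ^+ 2) * (b k * gauss_weight (x k.+1)) /\
  b k * gauss_weight (x k.+1) <=
    expR (3 * L ^+ 2 / s ^+ 2) * (b k.+1 * gauss_weight (x k)).
Proof.
move=> xk; have s0 := window_sd_gt0; case/andP: P01 => P0 P1.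
have sL' := sL; have K1' := K1.
have := binomial_pmf_ratio xk.
move: xk; rewrite ler_norml => /andP[xk1 xk2].
have kN : (k < N)%N by exact: window_lt.
have bk := binomial_pmf_gt0 (ltnW kN); have bk1 := binomial_pmf_gt0 kN.
set r := s^-1; have r0 : 0 < r by rewrite invr_gt0.
have rL : L * r <= 2^-1.
  by rewrite ler_pdivrMr//; lra.
rewrite -exprVn -/r.
set v := x k * (1 - P) * r + (1 - P) * r ^+ 2; set u := x k * P * r => ratio.

have r1 : r <= 1 by nra.
have r2 : r ^+ 2 <= r by rewrite expr2 ler_piMl// ltW.
have r2L : r ^+ 2 <= L ^+ 2 * r ^+ 2.
  by rewrite ler_peMl ?sqr_ge0//; nra.
have sqrL z : `|z| <= L * r -> z ^+ 2 <= L ^+ 2 * r ^+ 2.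
  move=> zL; rewrite -exprMn -(real_normK (num_real z)).
  by rewrite lerXn2r ?nnegrE// (le_trans _ zL).
have xr1 : - (K * r) <= x k * r by rewrite -mulNr ler_wpM2r// ltW.
have xr2 : x k * r <= K * r by rewrite ler_wpM2r// ltW.
have uL : `|u| <= L * r.
  by rewrite /u mulrAC ler_norml; apply/andP; split; nra.
have vL : `|v| <= L * r.
  have -> : v = (x k * r + r ^+ 2) * (1 - P) by rewrite /v; ring.
  by rewrite ler_norml; apply/andP; split; nra.
have u2 := sqrL _ uL; have v2 := sqrL _ vL.
move: uL vL; rewrite !ler_norml => /andP[uL1 uL2] /andP[vL1 vL2].
have uv : u + v = x k * r + (1 - P) * r ^+ 2 by rewrite /u /v; ring.
have xS : (x k.+1) ^+ 2 = x k ^+ 2 + 2 * (x k * r) + r ^+ 2.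
  by rewrite standardizeS -/r; ring.
have q1 : (1 - P) * r ^+ 2 <= r ^+ 2 by rewrite ler_piMl ?sqr_ge0//; lra.
have q0 : 0 <= (1 - P) * r ^+ 2 by rewrite mulr_ge0 ?sqr_ge0//; lra.
rewrite ![expR (3 * _ * _) * _]mulrC -!mulrA -!expRD /gauss_weight.
have u'2 : - 2^-1 <= - u by lra.
have v'2 : - 2^-1 <= v by lra.
split.
- apply: (@expR_shift_le _ _ _ (v - 2 * v ^+ 2) (- u)); first exact: ltW.
    apply: le_trans (_ : b k.+1 * (1 + v) <= _).
      by rewrite ler_wpM2l ?expR_le1D// ltW.
    by rewrite ratio ler_wpM2l ?expR_ge1Dx// ltW.
  by rewrite xS; lra.
- apply: (@expR_shift_le _ _ _ (- u - 2 * (- u) ^+ 2) v); first exact: ltW.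
    apply: le_trans (_ : b k * (1 - u) <= _).
      by rewrite ler_wpM2l ?expR_le1D// ltW.
    by rewrite -ratio ler_wpM2l ?expR_ge1Dx// ltW.
  by rewrite xS sqrrN; lra.
Qed.

Definition gauss_ratio k := b k / gauss_weight (x k).

Lemma gauss_ratio_step k : `|x k| <= K ->
  gauss_ratio k.+1 <= expR (3 * L ^+ 2 / s ^+ 2) * gauss_ratio k /\
  gauss_ratio k <= expR (3 * L ^+ 2 / s ^+ 2) * gauss_ratio k.+1.
Proof.
move=> /binomial_gauss_step[h1 h2]; rewrite /gauss_ratio.
split; rewrite [leRHS]mulrA ler_pdivrMr ?expR_gt0// mulrAC ler_pdivlMr ?expR_gt0//.
  by rewrite -[leRHS]mulrA.
by rewrite -[leRHS]mulrA.
Qed.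

Lemma standardize_le k l : (k <= l)%N -> x k <= x l.
Proof. by move=> kl; rewrite ler_pM2r ?invr_gt0 ?window_sd_gt0// lerB// ler_nat. Qed.

Lemma gauss_ratio_chain j k : `|x k| <= K -> `|x (k + j)%N| <= K ->
  gauss_ratio (k + j)%N <= expR (j%:R * (3 * L ^+ 2 / s ^+ 2)) * gauss_ratio k /\
  gauss_ratio k <= expR (j%:R * (3 * L ^+ 2 / s ^+ 2)) * gauss_ratio (k + j)%N.
Proof.
elim: j => [|j IH] xk xkj; first by rewrite addn0 mul0r expR0 mul1r.
have xkj' : `|x (k + j)%N| <= K.
  move: xk xkj; rewrite !ler_norml => /andP[xk _] /andP[_ xkj].
  rewrite (le_trans xk) ?standardize_le ?leq_addr//=.
  by rewrite (le_trans _ xkj)// standardize_le// addnS.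
have [IH1 IH2] := IH xk xkj'; have [h1 h2] := gauss_ratio_step xkj'.
rewrite addnS -natr1 mulrDl mul1r expRD; split.
  by apply: le_trans h1 _; rewrite -[leRHS]mulrA [leRHS]mulrCA ler_wpM2l ?expR_ge0.
by apply: le_trans IH2 _; rewrite -[leRHS]mulrA ler_wpM2l ?expR_ge0.
Qed.

(** Two points of the window are at most 2 K s steps apart, and every step
    costs a factor exp(3 L^2 / s^2). *)
Lemma gauss_ratio_window k l : `|x k| <= K -> `|x l| <= K ->
  gauss_ratio k <= expR (6 * L ^+ 3 / s) * gauss_ratio l.
Proof.
have rho0 j : `|x j| <= K -> 0 <= gauss_ratio j.
  rewrite ler_norml => /andP[_ /window_lt/ltnW/binomial_pmf_gt0 bj].
  by rewrite divr_ge0 ?expR_ge0// ltW.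
have s0 := window_sd_gt0; have K1' := K1.
have h j i : `|x i| <= K -> `|x (i + j)%N| <= K ->
    expR (j%:R * (3 * L ^+ 2 / s ^+ 2)) <= expR (6 * L ^+ 3 / s).
  rewrite !ler_norml => /andP[xi _] /andP[_ xij].
  have jK : j%:R <= 2 * K * s.
    have := standardizeK (i + j)%N; rewrite natrD (standardizeK i) => e.
    have -> : j%:R = (x (i + j)%N - x i) * s by lra.
    by rewrite ler_wpM2r//; lra.
  rewrite ler_expR; apply: le_trans (_ : 2 * L * s * (3 * L ^+ 2 / s ^+ 2) <= _).
    have d0 : 0 <= 3 * L ^+ 2 / s ^+ 2 by rewrite divr_ge0 ?sqr_ge0// mulr_ge0 ?sqr_ge0.
    apply: ler_wpM2r => //.
    by apply: le_trans jK _; rewrite ler_wpM2r// ?ltW//; lra.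
  by rewrite le_eqVlt; apply/orP; left; apply/eqP; field; exact: lt0r_neq0.
move=> xk xl; have [kl|/ltnW lk] := leqP k l.
  have xl' : `|x (k + (l - k))%N| <= K by rewrite subnKC.
  have [_ c] := gauss_ratio_chain xk xl'; apply: le_trans c _; rewrite subnKC//.
  by rewrite ler_wpM2r ?rho0// (@h (l - k)%N k).
have xk' : `|x (l + (k - l))%N| <= K by rewrite subnKC.
have [+ _] := gauss_ratio_chain xl xk'; rewrite {1}subnKC// => c; apply: le_trans c _.
by rewrite ler_wpM2r ?rho0// (@h (k - l)%N l).
Qed.

Definition normal_cell k := Phi (x k.+1) - Phi (x k).

Lemma normal_cell_ge0 k : 0 <= normal_cell k.
Proof. by rewrite subr_ge0 Phi_nondecreasing// standardize_le. Qed.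

Lemma normal_cell_bounds k : `|x k| <= K ->
  normal_peak 1 * gauss_weight (x k) * s^-1 <= expR (L / s) * normal_cell k /\
  normal_cell k <= expR (L / s) * (normal_peak 1 * gauss_weight (x k) * s^-1).
Proof.
rewrite ler_norml => /andP[xk1 xk2]; have s0 := window_sd_gt0.
have K1' := K1; have sL' := sL.
have s1 : s^-1 <= 1 by rewrite invf_le1//; lra.
have xS : x k.+1 - x k = s^-1 by rewrite standardizeS addrAC subrr add0r.
have k1 : - L <= x k by lra.
have k2 : x k.+1 <= L by rewrite standardizeS; lra.
have /andP[] := PhiB_local (standardize_le (leqnSn k)) k1 k2.
rewrite xS -/(normal_cell k) !expRD expRN -/(gauss_weight (x k)).
set E := expR (L / s) => h1 h2.
have E0 : 0 < E by exact: expR_gt0.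
split.
  apply: le_trans (_ : E * (normal_peak 1 * (gauss_weight (x k) / E) * s^-1) <= _).
    rewrite le_eqVlt; apply/orP; left; apply/eqP; field.
    by rewrite !lt0r_neq0.
  by rewrite ler_wpM2l// ltW.
apply: le_trans h2 _; rewrite le_eqVlt; apply/orP; left; apply/eqP; ring.
Qed.

(** The unknown constant of proportionality between the weights and the cell
    masses cancels in this cross-multiplied form. *)
Lemma binomial_cell_window k l : `|x k| <= K -> `|x l| <= K ->
  b k * normal_cell l <= expR (8 * L ^+ 3 / s) * (b l * normal_cell k).
Proof.
move=> xk xl; have s0 := window_sd_gt0; have K1' := K1.
have [hk _] := normal_cell_bounds xk; have [_ hl] := normal_cell_bounds xl.
have hr := gauss_ratio_window xk xl.
have bE j : b j = gauss_ratio j * gauss_weight (x j).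
  by rewrite divfK// gt_eqF ?expR_gt0.
have b0 j : `|x j| <= K -> 0 < b j.
  by rewrite ler_norml => /andP[_ /window_lt/ltnW/binomial_pmf_gt0].
have g0 j : 0 < gauss_weight (x j) by exact: expR_gt0.
have rho0 j : `|x j| <= K -> 0 <= gauss_ratio j.
  by move=> xj; rewrite divr_ge0// ltW// b0.
have E0 := @expR_ge0 R (L / s).
apply: le_trans (_ : b k * (expR (L / s) *
   (normal_peak 1 * gauss_weight (x l) * s^-1)) <= _).
  by rewrite ler_wpM2l// ltW// b0.
apply: le_trans (_ : gauss_ratio k * gauss_weight (x l) * expR (L / s) *
   (normal_peak 1 * gauss_weight (x k) * s^-1) <= _).
  by rewrite bE le_eqVlt; apply/orP; left; apply/eqP; ring.
apply: le_trans (_ : gauss_ratio k * gauss_weight (x l) * expR (L / s) *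
   (expR (L / s) * normal_cell k) <= _).
  have A : 0 <= gauss_ratio k * gauss_weight (x l) * expR (L / s).
    by apply: mulr_ge0 => //; apply: mulr_ge0; [exact: rho0|exact: ltW].
  by rewrite ler_wpM2l.
apply: le_trans (_ : expR (6 * L ^+ 3 / s) * gauss_ratio l *
    (gauss_weight (x l) * expR (L / s) * (expR (L / s) * normal_cell k)) <= _).
  have A : 0 <= gauss_weight (x l) * expR (L / s) * (expR (L / s) * normal_cell k).
    by rewrite !mulr_ge0 ?normal_cell_ge0// ltW.
  apply: le_trans (ler_wpM2r A hr).
  by rewrite le_eqVlt; apply/orP; left; apply/eqP; ring.
rewrite (_ : _ * _ = expR (6 * L ^+ 3 / s) * expR (L / s) * expR (L / s) *
   (b l * normal_cell k)); last by rewrite bE; ring.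
rewrite ler_wpM2r ?mulr_ge0 ?normal_cell_ge0 ?(ltW (b0 _ _))// -!expRD ler_expR.
rewrite -!mulrDl ler_pM2r ?invr_gt0//.
have : 0 <= L * (L ^+ 2 - 1) by nra.
nra.
Qed.

(** The masses of the cells telescope.  A cell that starts in the window may
    stick out of it on the right, and the first one may start up to 1 / s after
    - K, hence the shift of the left end point. *)
Lemma window_cells_ge :
  Phi K - Phi (- K + s^-1) <= \sum_(k < N.+1 | `|x k| <= K) normal_cell k.
Proof.
have s0 := window_sd_gt0; have K1' := K1; have sL' := sL.
have s1 : s^-1 <= 1 by rewrite invf_le1//; lra.
have s1' : 0 < s^-1 by rewrite invr_gt0.
(* Clamping the end points to the target interval sends the cells that start
   outside the window to empty ones and shrinks the others. *)
pose c z := Num.max (- K + s^-1) (Num.min z K).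
have cmono y z : y <= z -> c y <= c z.
  by move=> yz; rewrite /c le_max2// le_min2.
have <- : \sum_(k < N.+1) (Phi (c (x k.+1)) - Phi (c (x k))) = Phi K - Phi (- K + s^-1).
  rewrite -(big_mkord xpredT (fun k => Phi (c (x k.+1)) - Phi (c (x k)))).
  rewrite telescope_sumr//; congr (Phi _ - Phi _).
    have : K < x N.+1 by rewrite ltNge; apply/negP => /window_lt; rewrite ltnNge leqnSn.
    by rewrite /c minElt maxElt; do 2 case: ifPn => //; lra.
  have : x 0 <= - K.
    rewrite /standardize sub0r mulNr lerN2 ler_pdivlMr//.
    apply: le_trans (_ : s * s <= _); first by rewrite ler_wpM2r//; lra.
    rewrite -expr2 s2E [leRHS]mulrC; case/andP: P01 => P0 P1.
    by apply: ler_piMr; [apply: mulr_ge0 => //; exact: ltW|lra].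
  by rewrite /c minElt maxElt; do 2 case: ifPn => //; lra.
rewrite [leRHS]big_mkcond/=; apply: ler_sum => k _.
have yE := standardizeS k.
case: ifPn => [|/negP xk].
  rewrite ler_norml => /andP[xk1 xk2]; apply: lerB; apply: Phi_nondecreasing.
    by rewrite /c ge_max ge_min; apply/andP; split; [lra|rewrite lexx].
  by rewrite /c le_max le_min lexx xk2 orbT.
rewrite (_ : c (x k.+1) = c (x k)) ?subrr//.
have [xK|xK] := ltP K (x k).
  by rewrite /c !minElt !maxElt; do 4 case: ifPn => //; lra.
have xK' : x k < - K.
  by rewrite ltNge; apply/negP => h; apply: xk; rewrite ler_norml h.
by rewrite /c !minElt !maxElt; do 4 case: ifPn => //; lra.
Qed.

(** [binomial_cell_window] summed over all l in the window: the binomial weights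
    on the right add up to at most 1 and the cell masses on the left to at least
    the mass of the window, which bounds the constant of proportionality from
    above.  Applied to an event and to its complement, such an upper bound
    suffices for two-sided estimates. *)
Lemma binomial_le_cells (Q : pred nat) :
  (\sum_(k < N.+1 | Q k && (`|x k| <= K)) b k) * (Phi K - Phi (- K + s^-1)) <=
  expR (8 * L ^+ 3 / s) * \sum_(k < N.+1 | Q k && (`|x k| <= K)) normal_cell k.
Proof.
have b0 k : (k < N.+1)%N -> 0 <= b k by move=> kN; rewrite ltW// binomial_pmf_gt0.
set B := \sum_(k < N.+1 | _) b k.
have B0 : 0 <= B by apply: sumr_ge0 => k _; exact: b0.
apply: le_trans (ler_wpM2l B0 window_cells_ge) _.
have W1 : \sum_(k < N.+1 | `|x k| <= K) b k <= 1.
  rewrite -(binomial_sum1 N P) [leLHS]big_mkcond/=; apply: ler_sum => k _.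
  by case: ifP => // _; exact: b0.
rewrite -[leRHS]mulr1.
apply: le_trans (ler_wpM2l _ W1); last first.
  by apply: mulr_ge0; [exact: expR_ge0|apply: sumr_ge0 => k _; exact: normal_cell_ge0].
rewrite /B [leLHS]mulr_suml [X in _ <= X * _]mulr_sumr [leRHS]mulr_suml.
apply: ler_sum => k /andP[_ xk].
rewrite !mulr_sumr; apply: ler_sum => l xl.
by rewrite -[leRHS]mulrA (mulrC (normal_cell k)); exact: binomial_cell_window.
Qed.

Lemma normal_cells_le_Phi t :
  \sum_(k < N.+1 | (x k <= t) && (`|x k| <= K)) normal_cell k <= Phi (t + s^-1).
Proof.
pose c z := Num.min z (t + s^-1).
have s0 := window_sd_gt0; have s1' : 0 < s^-1 by rewrite invr_gt0.
apply: le_trans (_ : \sum_(k < N.+1) (Phi (c (x k.+1)) - Phi (c (x k))) <= _).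
  rewrite big_mkcond/=; apply: ler_sum => k _; have yE := standardizeS k.
  case: ifPn => [/andP[xt _]|_].
    by rewrite /normal_cell /c !min_l//; lra.
  by rewrite subr_ge0 Phi_nondecreasing// /c le_min2// standardize_le.
rewrite -(big_mkord xpredT (fun k => Phi (c (x k.+1)) - Phi (c (x k)))).
rewrite telescope_sumr//.
apply: le_trans (_ : Phi (c (x N.+1)) <= _); first by rewrite gerBl Phi_ge0.
by rewrite Phi_nondecreasing// /c ge_min lexx orbT.
Qed.

Lemma normal_cells_gt_Phi t :
  \sum_(k < N.+1 | (t < x k) && (`|x k| <= K)) normal_cell k <= 1 - Phi t.
Proof.
pose c z := Num.max z t.
have s0 := window_sd_gt0; have s1' : 0 < s^-1 by rewrite invr_gt0.
apply: le_trans (_ : \sum_(k < N.+1) (Phi (c (x k.+1)) - Phi (c (x k))) <= _).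
  rewrite big_mkcond/=; apply: ler_sum => k _; have yE := standardizeS k.
  case: ifPn => [/andP[xt _]|_].
    by rewrite /normal_cell /c !max_l//; lra.
  by rewrite subr_ge0 Phi_nondecreasing// /c le_max2// standardize_le.
rewrite -(big_mkord xpredT (fun k => Phi (c (x k.+1)) - Phi (c (x k)))).
rewrite telescope_sumr//.
apply: lerB; first exact: Phi_le1.
by rewrite Phi_nondecreasing// /c le_max lexx orbT.
Qed.

Lemma binomial_window_compl :
  \sum_(k < N.+1 | K < `|x k|) b k <= (K ^+ 2)^-1.
Proof.
have s0 := window_sd_gt0; have K1' := K1; have K0 : 0 < K by lra.
rewrite -[leRHS]mul1r ler_pdivlMr ?exprn_gt0// mulrC.
have s20 : 0 < s ^+ 2 by rewrite exprn_gt0.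
rewrite -(ler_pM2l s20) mulr1 mulrA -exprMn [leRHS]s2E.
have -> : \sum_(k < N.+1 | K < `|x k|) b k =
    \sum_(k < N.+1 | s * K < `|k%:R - P * N%:R|) b k.
  apply: eq_bigl => k; rewrite /standardize normrM [`|s^-1|]gtr0_norm ?invr_gt0//.
  by rewrite ltr_pdivlMr// mulrC.
apply: binomial_chebyshev; last by rewrite mulr_ge0// ltW.
by case/andP: P01 => *; rewrite !ltW.
Qed.
End local_limit.

(** * The central limit theorem for binomial variables *)

(** The bound s0 depends only on t and eps, so P may vary with N. *)
Theorem de_moivre_laplace {R : realType} (t eps : R) : 0 < eps ->
  exists s0, forall (N : nat) (P s : R), 0 < P < 1 ->
    s ^+ 2 = N%:R * P * (1 - P) -> s0 <= s ->
    `|\sum_(k < N.+1 | standardize (P * N%:R) s k <= t) binomial_pmf N P k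
      - Phi t| <= eps.
Proof.
move=> e0; pose eta := Num.min 1 (eps / 5).
have eta0 : 0 < eta by rewrite lt_min ltr01 divr_gt0.
have eta1 : eta <= 1 by rewrite ge_min lexx.
have etae : 5 * eta <= eps.
  have : eta <= eps / 5 by rewrite ge_min lexx orbT.
  lra.
have [K0 K00 HK0] := Phi_tails (divr_gt0 eta0 (ltr0n R 2)).
have ei0 : 0 < eta^-1 by rewrite invr_gt0.
(* K0 controls the normal tails; 1 leaves room for the shift by 1 / s of the left
   end point; eta^-1 makes Chebyshev's bound K^-2 at most eta. *)
pose K := K0 + 1 + eta^-1; pose L := K + 1.
have K1 : 1 <= K by rewrite /K; lra.
have L0 : 0 < 8 * L ^+ 3 by rewrite mulr_gt0// exprn_gt0// /L; lra.
have ln0 : 0 < ln (1 + eta) by rewrite ln_gt0//; lra.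
exists (Num.max (2 * L) (Num.max eta^-1 (8 * L ^+ 3 / ln (1 + eta)))) => N P s P01 s2E.
rewrite !ge_max => /andP[sL /andP[se sln]].
have s0 : 0 < s by rewrite (lt_le_trans _ sL)// /L; lra.
have r0 : 0 < s^-1 by rewrite invr_gt0.
have reta : s^-1 <= eta by rewrite invf_ple ?posrE.
have expL : expR (8 * L ^+ 3 / s) <= 1 + eta.
  rewrite -[leRHS]lnK ?posrE ?ler_expR; last lra.
  by rewrite ler_pdivrMr// [leRHS]mulrC -ler_pdivrMr.
pose D := Phi K - Phi (- K + s^-1).
have Dge : 1 - eta <= D.
  have KK0 : K0 <= K by rewrite /K; lra.
  have KK1 : K0 <= K - s^-1 by rewrite /K; lra.
  have [h1 _] := HK0 _ KK0; have [_ h2] := HK0 _ KK1.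
  by rewrite /D (_ : - K + s^-1 = - (K - s^-1)); [lra|ring].
have KK : (K ^+ 2)^-1 <= eta.
  rewrite invf_ple ?posrE ?exprn_gt0//; last lra.
  by rewrite (le_trans (_ : _ <= K)) ?ler_eXnr// /K; lra.
pose x := standardize (P * N%:R) s; pose b := binomial_pmf N P.
have b0 k : 0 <= b k.
  by apply: binomial_pmf_ge0; case/andP: P01 => *; rewrite !ltW.
(* D is the normal mass of the window, so that dividing by it costs at most a
   factor 1 + O(eta). *)
have key (Q : pred nat) (c : R) : 0 <= c <= 1 ->
    \sum_(k < N.+1 | Q k && (`|x k| <= K)) normal_cell N P s k <= c ->
    \sum_(k < N.+1 | Q k) b k <= c + 3 * eta.
  move=> /andP[c0 c1] hc.
  have := binomial_le_cells P01 K1 s2E sL Q; rewrite -/D.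
  set A := (X in X * D); set C := (X in _ * X) => AD.
  have A0 : 0 <= A by apply: sumr_ge0 => k _; exact: b0.
  have A1 : A <= 1.
    rewrite -(binomial_sum1 N P) [leLHS]big_mkcond/=; apply: ler_sum => k _.
    by case: ifP => // _; exact: b0.
  have AD' : A * D <= (1 + eta) * c.
    apply: le_trans AD _; apply: le_trans (ler_wpM2l (expR_ge0 _) hc) _.
    by rewrite ler_wpM2r.
  have AA : A <= c + 2 * eta by nra.
  rewrite (bigID (fun k : 'I_N.+1 => `|x k| <= K))/=.
  apply: le_trans (lerD AA (_ : _ <= eta)) _; last by lra.
  apply: le_trans KK; apply: le_trans (binomial_window_compl P01 K1 s2E sL).
  rewrite big_mkcond [leRHS]big_mkcond/=; apply: ler_sum => k _.
  rewrite -ltNge; case: (Q k) => /=; case: ifP => // _; exact: b0.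
have Phi01 (z : R) : 0 <= Phi z <= 1 by rewrite Phi_ge0 Phi_le1.
have up := key (fun k => x k <= t) _ (Phi01 _) (normal_cells_le_Phi N P K1 sL t).
have tr : Phi (t + s^-1) <= Phi t + eta.
  have /Phi_lipschitz : t <= t + s^-1 by lra.
  lra.
have Phi01' : 0 <= 1 - Phi t <= 1.
  by case/andP: (Phi01 t) => ? ?; apply/andP; split; lra.
have lo := key (fun k => t < x k) _ Phi01' (normal_cells_gt_Phi N P K1 sL t).
have := binomial_sum1 N P.
rewrite (bigID (fun k : 'I_N.+1 => x k <= t))/=.
under [X in _ + X]eq_bigl do rewrite -ltNge.
rewrite -/b => tot; rewrite ler_norml; apply/andP; split; lra.
Qed.

(** * G(n,p) as a mixture of the G(n,m) *)

Lemma card_edge n : #|edge n| = 'C(n, 2).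
Proof.
rewrite card_sig -[in RHS](card_ord n) -card_draws.
by apply: eq_card => e; rewrite !inE.
Qed.

Lemma card_graphs n m : #|[pred G : graph n | #|G| == m]| = 'C('C(n, 2), m).
Proof.
by rewrite -card_edge -card_draws; apply: eq_card => e; rewrite !inE.
Qed.

Lemma card_graph_le n (G : graph n) : (#|G| <= 'C(n, 2))%N.
Proof. by rewrite -card_edge max_card. Qed.

Lemma gnm_ge0 {R : realType} n m (G : graph n) : 0 <= gnm R m G.
Proof. by rewrite /gnm; case: ifP => // _; rewrite invr_ge0. Qed.

Lemma gnpE {R : realType} n (P : R) (G : graph n) :
  gnp P G = P ^+ #|G| * (1 - P) ^+ ('C(n, 2) - #|G|).
Proof.
rewrite /gnp (bigID (fun e => e \in G))/=; congr (_ * _).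
  by rewrite (eq_bigr (fun=> P)) ?prodr_const// => e ->.
rewrite (eq_bigr (fun=> 1 - P)); last by move=> e /negPf ->.
rewrite prodr_const -card_edge; congr (_ ^+ _).
by rewrite -(cardC (mem G)) addKn; apply: eq_card => e; rewrite !inE.
Qed.

(** Given its number of edges, G(n,p) is uniform: its mass at a graph depends
    on the number of edges only. *)
Lemma gnp_mixture {R : realType} n (P : R) (G : graph n) :
  gnp P G = \sum_(k < ('C(n, 2)).+1) binomial_pmf 'C(n, 2) P k * gnm R k G.
Proof.
have Gn := card_graph_le G; rewrite -ltnS in Gn.
rewrite (bigD1 (Ordinal Gn))//= big1 ?addr0; last first.
  move=> k kG; rewrite /gnm; case: eqP; rewrite ?mulr0// => Gk.
  by case/eqP: kG; apply/val_inj.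
rewrite /gnm eqxx card_graphs gnpE binomial_pmfE -[X in X / _]mulr_natr mulfK//.
by rewrite pnatr_eq0 -lt0n bin_gt0 -ltnS.
Qed.

Lemma Pr_gnp_mixture {R : realType} n (P : R) (A : pred (graph n)) :
  Pr (gnp P) A =
  \sum_(k < ('C(n, 2)).+1) binomial_pmf 'C(n, 2) P k * Pr (@gnm R n k) A.
Proof.
rewrite /Pr; under eq_bigr do rewrite gnp_mixture.
by rewrite exchange_big/=; apply: eq_bigr => k _; rewrite mulr_sumr.
Qed.

Lemma Pr_gnm_total {R : realType} n m : (m <= 'C(n, 2))%N ->
  Pr (@gnm R n m) predT = 1.
Proof.
move=> mn; rewrite /Pr /gnm -big_mkcond/= sumr_const card_graphs.
rewrite -[LHS]mulr_natr mulVf// pnatr_eq0 -lt0n.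
by rewrite bin_gt0.
Qed.

Lemma Pr_gnm_le {R : realType} n m (A B : pred (graph n)) :
  (forall G : graph n, #|G| = m -> A G -> B G) ->
  Pr (@gnm R n m) A <= Pr (@gnm R n m) B.
Proof.
move=> AB; rewrite /Pr [leLHS]big_mkcond [leRHS]big_mkcond/=.
apply: ler_sum => G _; have := gnm_ge0 (R := R) m G.
rewrite /gnm; case: eqP => [Gm|_]; last by case: (A G); case: (B G).
by have := AB G Gm; case: (A G); case: (B G) => //= /(_ isT).
Qed.

Lemma Pr_gnm_le1 {R : realType} n m (A : pred (graph n)) : (m <= 'C(n, 2))%N ->
  Pr (@gnm R n m) A <= 1.
Proof. by move=> mn; rewrite -(Pr_gnm_total mn); apply: Pr_gnm_le. Qed.

Lemma Pr_gnp_compl {R : realType} n (P : R) (A : pred (graph n)) :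
  Pr (gnp P) A + Pr (gnp P) (predC A) = 1.
Proof.
transitivity (Pr (@gnp R n P) predT); first by rewrite /Pr [RHS](bigID A).
rewrite Pr_gnp_mixture.
rewrite -(binomial_sum1 'C(n, 2) P); apply: eq_bigr => k _.
by rewrite Pr_gnm_total ?mulr1// -ltnS.
Qed.

(** Conditioning on the number k of edges.  Values in Q and values outside the
    window W are charged with their full binomial weight; for the others the
    conditional probability of A is at most delta. *)
Lemma Pr_gnp_le {R : realType} n (P delta : R) (A : pred (graph n))
    (Q W : pred nat) : 0 <= P <= 1 -> 0 <= delta ->
  (forall k, (k <= 'C(n, 2))%N -> ~~ Q k -> W k ->
     Pr (@gnm R n k) A <= delta) ->
  Pr (gnp P) A <=
    \sum_(k < ('C(n, 2)).+1 | Q k) binomial_pmf 'C(n, 2) P k +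
    \sum_(k < ('C(n, 2)).+1 | ~~ W k) binomial_pmf 'C(n, 2) P k + delta.
Proof.
move=> P01 d0 AB; rewrite Pr_gnp_mixture -[X in _ + X]mulr1.
rewrite -(binomial_sum1 'C(n, 2) P) mulr_sumr.
rewrite [X in X + _ + _]big_mkcond [X in _ + X + _]big_mkcond/= -!big_split/=.
apply: ler_sum => k _; have b0 := binomial_pmf_ge0 'C(n, 2) k P01.
have kn : (k <= 'C(n, 2))%N by rewrite -ltnS.
have le1 := Pr_gnm_le1 (R := R) A kn.
have db := mulr_ge0 d0 b0; have ab := ler_wpM2l b0 le1.
case: ifPn => Qk; case: ifPn => Wk; rewrite ?negbK in Wk; try lra.
by have := ler_wpM2l b0 (AB k kn Qk Wk); lra.
Qed.

(** * The mean number of copies in G(n,m) *)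

(** Complementation turns supersets of H of size m into subsets of the
    complement of H of size #|T| - m; this form stays correct, and gives 0, when
    m is smaller than #|H|. *)
Lemma card_supersets (T : finType) (H : {set T}) m : (m <= #|T|)%N ->
  #|[pred G : {set T} | (H \subset G) && (#|G| == m)]| =
    'C(#|T| - #|H|, #|T| - m).
Proof.
move=> mT; have cC (B : {set T}) : (#|T| - #|B|)%N = #|~: B|.
  by rewrite -(cardsC B) addKn.
rewrite cC -cards_draws -[LHS](card_imset _ (@finset.setC_inj T)).
apply: eq_card => B; rewrite !inE; apply/imsetP/andP => [[G]|[BH /eqP Bm]].
  by rewrite !inE => /andP[HG /eqP <-] ->; rewrite finset.setCS cC eqxx.
exists (~: B); last by rewrite finset.setCK.
rewrite !inE -finset.setCS finset.setCK BH/=; apply/eqP; apply: (@addnI #|B|).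
by rewrite cardsC Bm subnK.
Qed.

Lemma bin_sub_prod {R : realType} N m h : (m <= N)%N -> (h <= N)%N ->
  'C(N - h, N - m)%:R =
    'C(N, m)%:R * \prod_(i < h) ((m%:R - i%:R) / (N%:R - i%:R)) :> R.
Proof.
move=> mN; elim: h => [|h IH] hN; first by rewrite big_ord0 mulr1 subn0 bin_sub.
rewrite big_ord_recr/= mulrA -IH 1?ltnW//.
have Nh : (0 < N - h)%N by rewrite subn_gt0.
have Nh0 : N%:R - h%:R != 0 :> R by rewrite -natrB 1?ltnW// pnatr_eq0 -lt0n.
apply: (mulIf Nh0); rewrite -[RHS]mulrA divfK//.
have [hm|mh] := leqP h m; last by rewrite !bin_small ?mul0r//; lia.
rewrite -(natrB _ hm) -(natrB _ (ltnW hN)) -!natrM; congr _%:R.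
have hE : (m - h = N - h - (N - m))%N by lia.
by rewrite hE mulnC [RHS]mulnC subnS mul_bin_down.
Qed.

Lemma Ex_ncopies {R : realType} n m h (S : {set graph n}) :
  (m <= 'C(n, 2))%N -> (h <= 'C(n, 2))%N -> (forall H : graph n, H \in S -> #|H| = h) ->
  Ex (@gnm R n m) (fun G => (ncopies S G)%:R) =
  #|S|%:R * \prod_(i < h) ((m%:R - i%:R) / (nedges R n - i%:R)).
Proof.
move=> mN hN hS; rewrite /Ex /ncopies.
transitivity (\sum_(H in S) \sum_(G : graph n | H \subset G) gnm R m G).
  under eq_bigr do rewrite -sum1_card natr_sum mulr_sumr.
  rewrite (exchange_big_dep (mem S))/=; last by move=> ? ? _ /andP[].
  by apply: eq_bigr => H HS; apply: eq_big => [?|? _]; rewrite ?inE ?HS ?mulr1.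
transitivity (\sum_(H in S) \prod_(i < h) ((m%:R - i%:R) / (nedges R n - i%:R)) : R).
  apply: eq_bigr => H HS; rewrite /gnm -big_mkcondr/= sumr_const card_graphs.
  rewrite (card_supersets H) ?card_edge// (hS H HS) -[LHS]mulr_natl.
  by rewrite bin_sub_prod// mulrC mulKf// pnatr_eq0 -lt0n bin_gt0.
by rewrite sumr_const -[LHS]mulr_natl.
Qed.

(** * The logarithm of the mean number of copies *)

Lemma ln1D_approx {R : realType} (y : R) : `|y| <= 2^-1 ->
  `|ln (1 + y) - y| <= 2 * y ^+ 2.
Proof.
rewrite ler_norml => /andP[y1 y2].
have y0 : 0 < 1 + y by lra.
have up : ln (1 + y) <= y by apply: le_ln1Dx; lra.
have lo : y - 2 * y ^+ 2 <= ln (1 + y).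
  by rewrite -ler_expR lnK ?posrE// expR_le1D.
by rewrite ler_norml; apply/andP; split; [lra|have := sqr_ge0 y; lra].
Qed.

Lemma ln1D_le {R : realType} (y : R) : `|y| <= 2^-1 -> `|ln (1 + y)| <= 2 * `|y|.
Proof.
move=> y2; have := ln1D_approx y2.
rewrite -(real_normK (num_real y)) => h.
have := ler_normD (ln (1 + y) - y) y; rewrite subrK.
have : `|y| ^+ 2 <= 2^-1 * `|y| by rewrite expr2 ler_wpM2r.
lra.
Qed.

Section falling.
Variables (R : realType) (N P m : R) (h : nat).
Hypotheses (P01 : 0 < P < 1) (N0 : 0 < N).
Local Notation a := (P * N).
Local Notation d := ((m - a) / a).
Hypothesis small : `|d| + h%:R / a <= 2^-1.

Let a0 : 0 < a. Proof. by case/andP: P01 => *; rewrite mulr_gt0. Qed.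

(** The factor is (1 + u) / (1 + w) with u = d - i / a and w = - i / N, and
    u - w = d - i (1 - P) / a since a = P N. *)
Lemma falling_factor i : (i < h)%N ->
  0 < (m - i%:R) / (N - i%:R) / P /\
  `|ln ((m - i%:R) / (N - i%:R) / P) - (d - i%:R * ((1 - P) / a))| <=
    4 * d ^+ 2 + 6 * (h%:R / a) ^+ 2.
Proof.
move=> ih; have a0' := a0; have sm := small; case/andP: P01 => P0 P1.
have an0 := lt0r_neq0 a0'; have Pn0 := lt0r_neq0 P0; have Nn0 := lt0r_neq0 N0.
pose v := i%:R / a; pose u := d - v; pose w := - (P * v).
have v0 : 0 <= v by rewrite divr_ge0// ltW.
have vh : v <= h%:R / a by rewrite ler_pM2r ?invr_gt0// ler_nat ltnW.
have d0 := normr_ge0 d.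
have w2 : `|w| <= 2^-1.
  have Pv : 0 <= P * v by apply: mulr_ge0 => //; exact: ltW.
  rewrite normrN ger0_norm//.
  by apply: le_trans (ler_piMl v0 (ltW P1)) _; lra.
have u2 : `|u| <= 2^-1.
  by have := ler_normB d v; rewrite (ger0_norm v0) -/u; lra.
have u1 : 0 < 1 + u by move: u2; rewrite ler_norml => /andP[]; lra.
have w1 : 0 < 1 + w by move: w2; rewrite ler_norml => /andP[]; lra.
have E : (m - i%:R) / (N - i%:R) / P = (1 + u) / (1 + w).
  have -> : 1 + u = (m - i%:R) / a by rewrite /u /v; field; rewrite Nn0 Pn0.
  have we : 1 + w = (N - i%:R) / N by rewrite /w /v; field; rewrite Nn0 Pn0.
  have Ni : N - i%:R != 0.
    by apply/eqP => Ni; move: w1; rewrite we Ni mul0r ltxx.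
  by rewrite we; field; rewrite Nn0 Pn0 Ni.
rewrite E; split; first exact: divr_gt0.
rewrite ln_div ?posrE//.
have -> : d - i%:R * ((1 - P) / a) = u - w by rewrite /u /w /v; ring.
have := ler_normB (ln (1 + u) - u) (ln (1 + w) - w).
rewrite (_ : _ - _ - _ = ln (1 + u) - ln (1 + w) - (u - w)); last by ring.
have hu := ln1D_approx u2; have hw := ln1D_approx w2.
have u2' : u ^+ 2 <= 2 * d ^+ 2 + 2 * v ^+ 2.
  by rewrite /u; have := sqr_ge0 (d + v); nra.
have w2' : w ^+ 2 <= v ^+ 2.
  by rewrite /w sqrrN exprMn ler_piMl ?sqr_ge0// expr_le1// ltW.
have vh' : v ^+ 2 <= (h%:R / a) ^+ 2 by rewrite lerXn2r ?nnegrE// (le_trans v0).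
lra.
Qed.

(** The linear terms sum to h d - h (h - 1) (1 - P) / (2 a); replacing
    h (h - 1) by h^2 accounts for the last error term. *)
Lemma falling_product :
  0 < \prod_(i < h) ((m - i%:R) / (N - i%:R) / P) /\
  `|ln (\prod_(i < h) ((m - i%:R) / (N - i%:R) / P)) -
     (h%:R * d - h%:R ^+ 2 * ((1 - P) / a) / 2)| <=
  h%:R * (4 * d ^+ 2 + 6 * (h%:R / a) ^+ 2) + h%:R / a.
Proof.
have a0' := a0; case/andP: P01 => P0 P1.
set C := 4 * d ^+ 2 + _.
have H j : (j <= h)%N -> 0 < \prod_(i < j) ((m - i%:R) / (N - i%:R) / P) /\
  `|ln (\prod_(i < j) ((m - i%:R) / (N - i%:R) / P)) -
     (j%:R * d - j%:R * (j%:R - 1) * ((1 - P) / a) / 2)| <= j%:R * C.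
  elim: j => [|j IH] jh; first by rewrite big_ord0 ln1 !mul0r !subr0 normr0.
  have [p0 IHj] := IH (ltnW jh); have [f0 fj] := falling_factor jh.
  rewrite big_ord_recr/=; split; first exact: mulr_gt0.
  rewrite lnM ?posrE// -natr1.
  have /le_trans := ler_normD
    (ln (\prod_(i < j) ((m - i%:R) / (N - i%:R) / P)) -
       (j%:R * d - j%:R * (j%:R - 1) * ((1 - P) / a) / 2))
    (ln ((m - j%:R) / (N - j%:R) / P) - (d - j%:R * ((1 - P) / a))).
  move=> /(_ _ (lerD IHj fj)) bound.
  rewrite [leRHS]mulrDl mul1r; apply: le_trans bound.
  rewrite le_eqVlt; apply/orP; left; apply/eqP.
  congr `|_|; lra.
have [p0 ph] := H h (leqnn h); split => //.
have := ler_normB (ln (\prod_(i < h) ((m - i%:R) / (N - i%:R) / P)) -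
     (h%:R * d - h%:R * (h%:R - 1) * ((1 - P) / a) / 2)) (- (h%:R * ((1 - P) / a) / 2)).
rewrite (_ : _ - _ - _ = ln (\prod_(i < h) ((m - i%:R) / (N - i%:R) / P)) -
     (h%:R * d - h%:R ^+ 2 * ((1 - P) / a) / 2)); last by ring.
move/le_trans; apply; apply: lerD => //.
have ha : 0 <= h%:R / a by rewrite divr_ge0// ltW.
have -> : h%:R * ((1 - P) / a) / 2 = h%:R / a * ((1 - P) / 2) by ring.
have haq : 0 <= h%:R / a * ((1 - P) / 2) by apply: mulr_ge0 => //; lra.
by rewrite normrN ger0_norm// ler_piMr//; lra.
Qed.

End falling.

Definition gnp_mean {R : realType} (p : nat -> R) n : R := p n * nedges R n.

Definition gnp_sd {R : realType} (p : nat -> R) n : R :=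
  Num.sqrt (nedges R n * p n * (1 - p n)).

Lemma gnp_sd_sqr {R : realType} (p : nat -> R) n : 0 < p n < 1 ->
  gnp_sd p n ^+ 2 = nedges R n * p n * (1 - p n).
Proof.
case/andP=> p0 p1; rewrite sqr_sqrtr// /nedges !mulr_ge0 ?(ltW p0)//.
by rewrite subr_ge0 ltW.
Qed.

(** Hence beta * (m - a) / s = h d and beta^2 = h^2 (1 - p) / a, the two terms
    of [falling_product]. *)
Lemma betaE {R : realType} (p : nat -> R) (h : nat -> nat) n : 0 < p n < 1 ->
  beta p h n = (h n)%:R * (gnp_sd p n / gnp_mean p n).
Proof.
move=> p01; rewrite /beta -/(gnp_mean p n); congr (_ * _).
have [a0|a0] := eqVneq (gnp_mean p n) 0.
  by rewrite a0 invr0 !mulr0 sqrtr0.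
have a1 : 0 <= gnp_mean p n.
  by case/andP: p01 => p0 _; rewrite mulr_ge0 ?(ltW p0)// /nedges.
rewrite -[RHS]ger0_norm ?divr_ge0 ?sqrtr_ge0// -sqrtr_sqr; congr (Num.sqrt _).
rewrite exprMn gnp_sd_sqr// exprVn (mulrC (nedges R n)) -/(gnp_mean p n).
by field.
Qed.

(** The value 0 of a quotient with a zero denominator is not within 1/2 of 1, so
    the closeness of X to its mean already implies that the mean and X are
    positive, hence that S is nonempty and h <= N. *)
Lemma log_count_close {R : realType} (p : nat -> R) (h : nat -> nat)
    (S : forall n, {set graph n}) n (G : graph n) (theta : R) :
  let a := gnp_mean p n in let d := (#|G|%:R - a) / a in
  let X := fun G' : graph n => (ncopies (S n) G')%:R : R in
  0 < p n < 1 -> (forall H : graph n, H \in S n -> #|H| = h n) ->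
  0 < beta p h n ->
  `|d| + (h n)%:R / a <= 2^-1 -> theta <= 2^-1 ->
  `|X G / Ex (@gnm R n #|G|) X - 1| <= theta ->
  exists2 r, log_count p h S G = r%:E &
    beta p h n * `|r - standardize a (gnp_sd p n) #|G| | <=
      2 * theta + ((h n)%:R * (4 * d ^+ 2 + 6 * ((h n)%:R / a) ^+ 2) + (h n)%:R / a).
Proof.
move=> a d X p01 hS b0 small th XE.
have [p0 p1] := andP p01.
have bE := betaE h p01.
have s0 : gnp_sd p n != 0.
  by apply/eqP => s0; move: b0; rewrite bE s0 mul0r mulr0 ltxx.
have aN0 : a != 0.
  by apply/eqP => a0; move: b0; rewrite bE -/a a0 invr0 !mulr0 ltxx.
have N0 : 0 < nedges R n.
  rewrite lt0r /nedges ler0n andbT; apply: contra_neq aN0 => N0.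
  by rewrite /a /gnp_mean /nedges N0 mulr0.
have a0 : 0 < a by exact: mulr_gt0.
set E := Ex (@gnm R n #|G|) X in XE *.
have XEpos : 2^-1 <= X G / E by move: XE; rewrite ler_norml => /andP[]; lra.
have EX0 : X G != 0 by apply/eqP => X0; move: XEpos; rewrite X0 mul0r; lra.
have [H /andP[HS HG]] : exists H, (H \in S n) && (H \subset G).
  have : (0 < ncopies (S n) G)%N by rewrite lt0n -(pnatr_eq0 R).
  by case/card_gt0P => H; rewrite !inE; exists H.
have hN : (h n <= 'C(n, 2))%N by rewrite -(hS _ HS) card_graph_le.
have EE : E = #|S n|%:R * \prod_(i < h n) ((#|G|%:R - i%:R) / (nedges R n - i%:R)).
  exact: Ex_ncopies (card_graph_le G) hN hS.
have [prod0 lnprod] := falling_product p01 N0 small.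
have S0 : 0 < #|S n|%:R :> R by rewrite ltr0n; apply/card_gt0P; exists H.
set F := \prod_(i < _) _ in prod0 lnprod.
have EF : E = lambda p h S n * F.
  rewrite EE /lambda -mulrA; congr (_ * _).
  rewrite /F [in RHS]big_split/= big_const_ord iter_mulr_1 exprVn.
  by rewrite mulrCA mulfV ?mulr1// expf_neq0// gt_eqF.
have lam0 : 0 < lambda p h S n by rewrite mulr_gt0// exprn_gt0.
have E0 : 0 < E by rewrite EF mulr_gt0.
exists ((ln (X G / E) + (beta p h n ^+ 2 / 2 + ln F)) / beta p h n).
  rewrite /log_count.
  have -> : expR (beta p h n ^+ 2 / 2) * (ncopies (S n) G)%:R / lambda p h S n =
      X G / E * (expR (beta p h n ^+ 2 / 2) * F).
    by rewrite EF /X; field; rewrite !gt_eqF.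
  have XEp : 0 < X G / E by lra.
  have eF0 : 0 < expR (beta p h n ^+ 2 / 2) * F by rewrite mulr_gt0 ?expR_gt0.
  rewrite lne_EFin; last exact: mulr_gt0.
  have -> : ln (X G / E * (expR (beta p h n ^+ 2 / 2) * F)) =
      ln (X G / E) + ln (expR (beta p h n ^+ 2 / 2) * F) by apply: lnM; rewrite posrE.
  rewrite (_ : ln (_ * F) = beta p h n ^+ 2 / 2 + ln F); last first.
    by rewrite lnM ?posrE ?expR_gt0// expRK.
  by rewrite inver gt_eqF.
rewrite -{1}(gtr0_norm b0) -normrM mulrBr mulrC divfK ?gt_eqF//.
have -> : beta p h n * standardize a (gnp_sd p n) #|G| = (h n)%:R * d.
  by rewrite bE /standardize /d -/a; field; rewrite ?s0 ?aN0.
have b2 : beta p h n ^+ 2 = (h n)%:R ^+ 2 * ((1 - p n) / a).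
  rewrite bE -/a exprMn expr_div_n gnp_sd_sqr// (mulrC (nedges R n)) -/a.
  by congr (_ * _); rewrite /a /gnp_mean; field; rewrite !gt_eqF.
have -> : ln (X G / E) + (beta p h n ^+ 2 / 2 + ln F) - (h n)%:R * d =
  ln (1 + (X G / E - 1)) + (ln F - ((h n)%:R * d - (h n)%:R ^+ 2 * ((1 - p n) / a) / 2)).
  have -> : 1 + (X G / E - 1) = X G / E by ring.
  by rewrite b2; ring.
apply: le_trans (ler_normD _ _) (lerD _ lnprod).
have := ln1D_le (le_trans XE th); lra.
Qed.

(** * Asymptotic scales *)

Lemma near_ge_of_limn_einf_gt0 {R : realType} (u : nat -> R) :
  (0 < limn_einf (fun n => (u n)%:E))%E ->
  exists2 c, 0 < c & \forall n \near \oo, c <= u n.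
Proof.
rewrite limn_einf_lim.
have /cvg_lim -> // := @cvg_einfs_sup R (fun n => (u n)%:E).
move=> /ereal_sup_gt[_ [n _ <-]].
set e := einfs _ n => e0.
have elb k : (n <= k)%N -> (e <= (u k)%:E)%E.
  by move=> nk; apply: ereal_inf_lbound; exists k.
have efin : e \is a fin_num.
  rewrite fin_numElt; apply/andP; split; first exact: lt_trans e0.
  by rewrite (le_lt_trans (elb n _))// ltry.
exists (fine e); first by rewrite fine_gt0// e0 ltey_eq efin.
by exists n => // k /= nk; rewrite -lee_fin fineK// elb.
Qed.

(** From c a <= h s, h^3 <= eta a^2 and s^2 <= a follow c^3 <= eta s and then
    (h / a)^3 <= eta / a <= eta / s^2 <= (eta / c^2)^3.  So a small eta makes s
    large and h / a small, and with them h d^2 <= K^2 h / a and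
    h (h / a)^2 <= eta. *)
Lemma scales_small {R : realType} (c K eps M : R) : 0 < c -> 0 < K -> 0 < eps ->
  exists2 eta, 0 < eta & forall a s h : R, 0 < a -> 0 < s -> s ^+ 2 <= a -> 0 <= h ->
    h ^+ 3 <= eta * a ^+ 2 -> c <= h * (s / a) ->
    M <= s /\ forall d, `|d| <= K * (s / a) ->
      `|d| + h / a <= 2^-1 /\
      h * (4 * d ^+ 2 + 6 * (h / a) ^+ 2) + h / a <= eps.
Proof.
move=> c0 K0 e0; pose M' := Num.max M (4 * K).
have M'0 : 0 < M' by rewrite lt_max orbC mulr_gt0.
pose eps' := Num.min (4^-1) (eps / (2 * (4 * K ^+ 2 + 1))).
have K2 : 0 <= K ^+ 2 by exact: sqr_ge0.
have eps'0 : 0 < eps'.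
  by rewrite lt_min invr_gt0 ltr0n/= divr_gt0//; lra.
pose eta := Num.min (c ^+ 3 / M') (Num.min (c ^+ 2 * eps') (eps / 12)).
have c20 : 0 < c ^+ 2 by rewrite exprn_gt0.
have c30 : 0 < c ^+ 3 by rewrite exprn_gt0.
have eta0 : 0 < eta by rewrite !lt_min divr_gt0// mulr_gt0// divr_gt0.
have eta1 : eta * M' <= c ^+ 3 by rewrite -ler_pdivlMr// ge_min lexx.
have eta2 : eta <= c ^+ 2 * eps' by rewrite /eta !ge_min lexx orbT.
have eta3 : eta <= eps / 12 by rewrite /eta !ge_min lexx !orbT.
exists eta => // a s h a0 s0 sa h0 h3 ch.
have a20 : 0 < a ^+ 2 by rewrite exprn_gt0.
have cs : c ^+ 3 <= eta * s.
  have /(lerXn2r 3) : c * a <= h * s.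
    by move: ch; rewrite mulrA ler_pdivlMr.
  rewrite !nnegrE => /(_ (mulr_ge0 (ltW c0) (ltW a0)) (mulr_ge0 h0 (ltW s0))).
  rewrite !exprMn => h1.
  have s30 : 0 < s ^+ 3 by rewrite exprn_gt0.
  have h2 : c ^+ 3 * a * a ^+ 2 <= eta * s ^+ 3 * a ^+ 2.
    have := ler_wpM2r (ltW s30) h3; lra.
  rewrite ler_pM2r// in h2.
  have h4 := ler_wpM2l (ltW c30) sa.
  have s20 : 0 < s ^+ 2 by rewrite exprn_gt0.
  by rewrite -(ler_pM2r s20); lra.
have Ms : M' <= s by rewrite -(ler_pM2l eta0); lra.
have ha : h / a <= eps'.
  have ha0 : 0 <= h / a by rewrite divr_ge0// ltW.
  apply: le_trans (_ : eta / c ^+ 2 <= _); last by rewrite ler_pdivrMr// mulrC.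
  have ec0 : 0 <= eta / c ^+ 2 by rewrite divr_ge0// ltW.
  rewrite -(@ler_pXn2r _ 3)// ?nnegrE//.
  have s20 : 0 < s ^+ 2 by rewrite exprn_gt0.
  have h1 : (h / a) ^+ 3 * s ^+ 2 <= eta.
    apply: le_trans (_ : (h / a) ^+ 3 * a <= _).
      by apply: ler_wpM2l => //; rewrite exprn_ge0.
    have -> : (h / a) ^+ 3 * a = h ^+ 3 / a ^+ 2 by field; rewrite gt_eqF.
    by rewrite ler_pdivrMr.
  rewrite -(ler_pM2r s20); apply: le_trans h1 _.
  have -> : (eta / c ^+ 2) ^+ 3 * s ^+ 2 = eta * ((eta * s) ^+ 2 / (c ^+ 3) ^+ 2).
    by field; rewrite gt_eqF.
  rewrite ler_peMr ?(ltW eta0)// ler_pdivlMr ?exprn_gt0// mul1r.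
  by rewrite lerXn2r ?nnegrE// ?mulr_ge0// ltW.
split; first by apply: le_trans Ms; rewrite /M' le_max lexx.
move=> d dK.
have sas : s / a <= s^-1.
  by rewrite ler_pdivrMr// mulrC ler_pdivlMr// -expr2.
have d4 : `|d| <= 4^-1.
  apply: le_trans dK _; apply: le_trans (ler_wpM2l (ltW K0) sas) _.
  rewrite ler_pdivrMr//; have : 4 * K <= M' by rewrite /M' le_max lexx orbT.
  lra.
have ha4 : h / a <= 4^-1 by apply: le_trans ha _; rewrite /eps' ge_min lexx.
split; first by lra.
have d2 : d ^+ 2 <= K ^+ 2 / a.
  rewrite -(real_normK (num_real d)).
  apply: le_trans (_ : (K * (s / a)) ^+ 2 <= _).
    by rewrite lerXn2r ?nnegrE// (le_trans _ dK).
  rewrite !exprMn ler_wpM2l// exprVn ler_pdivrMr//.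
  by rewrite (_ : a^-1 * a ^+ 2 = a)//; field; rewrite gt_eqF.
have hd2 : h * d ^+ 2 <= K ^+ 2 * (h / a).
  apply: le_trans (ler_wpM2l h0 d2) _; rewrite le_eqVlt; apply/orP; left.
  by apply/eqP; ring.
have hha : h * (h / a) ^+ 2 <= eta.
  have -> : h * (h / a) ^+ 2 = h ^+ 3 / a ^+ 2 by field; rewrite gt_eqF.
  by rewrite ler_pdivrMr.
have Kha : (4 * K ^+ 2 + 1) * (h / a) <= eps / 2.
  have K40 : 0 < 4 * K ^+ 2 + 1 by lra.
  rewrite mulrC -ler_pdivlMr//; apply: le_trans ha _.
  by rewrite /eps' -mulrA -invfM ge_min lexx orbT.
lra.
Qed.

Lemma nedges_ge {R : realType} n : (2 <= n)%N -> n%:R ^+ 2 <= 4 * nedges R n.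
Proof.
case: n => [//|n] n2; have := mul_bin_diag n.+1 1; rewrite bin1 /= => e.
have {e} e : (n%:R + 1) * n%:R = 2 * nedges R n.+1.
  by rewrite /nedges natr1 -!natrM e.
have : 1 <= n%:R :> R by rewrite ler1n.
rewrite -natr1; nra.
Qed.

Lemma near_scales {R : realType} (p : nat -> R) (h : nat -> nat) (c : R) :
  (forall n, 0 < p n < 1) ->
  (fun n => (h n)%:R ^+ 3 : R) =o_\oo (fun n => p n ^+ 2 * n%:R ^+ 4 : R) ->
  0 < c -> (\forall n \near \oo, c <= beta p h n) ->
  forall eta, 0 < eta -> \forall n \near \oo,
    [/\ 0 < gnp_mean p n, 0 < gnp_sd p n, gnp_sd p n ^+ 2 <= gnp_mean p n,
      (h n)%:R ^+ 3 <= eta * gnp_mean p n ^+ 2 &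
      c <= (h n)%:R * (gnp_sd p n / gnp_mean p n)].
Proof.
move=> hp /eqoP hh c0 hc eta eta0.
have hh' := hh _ (divr_gt0 eta0 (ltr0n R 16)); near=> n.
have [p0 p1] := andP (hp n).
have n2 : (2 <= n)%N by near: n; exact: nbhs_infty_ge.
have nN := nedges_ge (R := R) n2.
have n20 : 0 < n%:R ^+ 2 :> R by rewrite exprn_gt0// ltr0n ltnW.
have N0 : 0 < nedges R n by lra.
have a0 : 0 < gnp_mean p n by exact: mulr_gt0.
have cb : c <= beta p h n by near: n.
rewrite betaE// in cb.
have s0 : 0 < gnp_sd p n.
  rewrite lt0r sqrtr_ge0 andbT; apply: contraTneq cb => ->.
  by rewrite mul0r mulr0 -ltNge.
split => //.
  by rewrite gnp_sd_sqr// (mulrC (nedges R n)) ler_piMr ?ltW//; lra.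
have : `|(h n)%:R ^+ 3| <= eta / 16 * `|p n ^+ 2 * n%:R ^+ 4|.
  by near: n.
rewrite ger0_norm ?exprn_ge0// ger0_norm; last first.
  by rewrite mulr_ge0// exprn_ge0// ltW.
move=> /le_trans; apply.
have n4 : n%:R ^+ 4 <= 16 * nedges R n ^+ 2.
  rewrite (_ : 16 * _ = (4 * nedges R n) ^+ 2); last by ring.
  by rewrite (exprM _ 2 2) lerXn2r// nnegrE; lra.
have ep : 0 <= eta / 16 * p n ^+ 2 by rewrite mulr_ge0 ?sqr_ge0//; lra.
apply: le_trans (_ : eta / 16 * p n ^+ 2 * n%:R ^+ 4 <= _).
  by rewrite [leLHS]mulrA.
apply: le_trans (ler_wpM2l ep n4) _.
by rewrite /gnp_mean le_eqVlt; apply/orP; left; apply/eqP; field.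
Unshelve. all: by end_near. Qed.

(** * The logarithm of the number of copies is asymptotically normal *)

Theorem theorem3 (R : realType) (p : nat -> R) (h : nat -> nat)
    (S : forall n : nat, {set graph n})
    (hp : forall n, 0 < p n < 1)
    (hS : forall n (H : graph n), H \in S n -> #|H| = h n)
    (hh : (fun n => (h n)%:R ^+ 3 : R) =o_\oo
          (fun n => p n ^+ 2 * n%:R ^+ 4 : R))
    (hbeta : (0 < limn_einf (fun n => (beta p h n)%:E))%E)
    (hgnm : forall m : nat -> nat,
       (forall n, (m n <= 'C(n, 2))%N) ->
       (fun n => (m n)%:R - p n * nedges R n : R) =O_\oo
         (fun n => Num.sqrt (p n * nedges R n) : R) ->
       cvg_in_prob (fun n => @gnm R n (m n))
         (fun n G => (ncopies (S n) G)%:R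
            / Ex (@gnm R n (m n)) (fun G' => (ncopies (S n) G')%:R))
         1) :
  cvg_in_distr (fun n => @gnp R n (p n)) (log_count p h S)
    (normal_prob 0 1).
Proof.
have [c c0 hc] := near_ge_of_limn_einf_gt0 hbeta.
have scales := near_scales hp hh c0 hc.
move=> t _; rewrite [X in _ --> X](_ : _ = (Phi t)%:E); last by rewrite EFin_Phi.
apply: cvg_EFin; first exact: nearW.
apply/cvgrPdist_le => /= eps0 eps00.
pose eps := eps0 / 4; have e0 : 0 < eps by exact: divr_gt0.
pose K := 1 + eps^-1.
have ei0 : 0 < eps^-1 by rewrite invr_gt0.
have K1 : 1 <= K by rewrite /K; lra.
have K0 : 0 < K by lra.
have KK : (K ^+ 2)^-1 <= eps.
  rewrite invf_ple ?posrE ?exprn_gt0//.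
  by rewrite (le_trans (_ : _ <= K)) ?ler_eXnr// /K; lra.
pose theta := Num.min 2^-1 (c * eps / 4).
have ce0 : 0 < c * eps by exact: mulr_gt0.
have theta0 : 0 < theta by rewrite lt_min invr_gt0 ltr0n/= divr_gt0.
have theta1 : theta <= 2^-1 by rewrite ge_min lexx.
have theta2 : theta <= c * eps / 4 by rewrite ge_min lexx orbT.
have [s1 clt1] := de_moivre_laplace (t + eps) e0.
have [s2 clt2] := de_moivre_laplace (t - eps) e0.
pose X n (G : graph n) : R := (ncopies (S n) G)%:R.
pose bad n k (G : graph n) : bool := theta < `|X n G / Ex (@gnm R n k) (X n) - 1|.
pose near_mean n (k : nat) : bool := `|k%:R - gnp_mean p n| <= 1 + K * gnp_sd p n.
(* A worst case: if some k near the mean is bad, m n is such a k.  The window for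
   m is wider than K s by 1 so that it always contains the integer part of the
   mean. *)
pose m n : nat := if [pick k : 'I_('C(n, 2)).+1 |
    near_mean n k && (eps < Pr (@gnm R n k) (bad n k))] is Some k then k
  else Num.truncn (gnp_mean p n).
have [eta eta0 small] := scales_small
  (Num.max (Num.max s1 s2) (Num.max 1 (2 * (K + 1)))) c0 K0 (divr_gt0 ce0 (ltr0n R 2)).
have mean0 n : 0 <= gnp_mean p n.
  by case/andP: (hp n) => p0 _; rewrite mulr_ge0 ?(ltW p0)// /nedges.
have sd0 n : 0 <= gnp_sd p n by exact: sqrtr_ge0.
have mean_le n : gnp_mean p n <= 'C(n, 2)%:R.
  by case/andP: (hp n) => p0 p1; rewrite ler_piMl ?(ltW p1).
have mN n : (m n <= 'C(n, 2))%N.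
  rewrite /m; case: pickP => [k _|_]; first by rewrite -ltnS.
  by rewrite truncn_le_nat (le_lt_trans (mean_le n))// ltr_nat.
have mnear n : near_mean n (m n).
  rewrite /m; case: pickP => [k /andP[]//|_].
  rewrite /near_mean distrC ger0_norm ?subr_ge0 ?truncn_le//.
  have := truncnS_gt (gnp_mean p n); rewrite -natr1.
  have := mulr_ge0 (ltW K0) (sd0 n); lra.
pose large n := [/\ [/\ 0 < gnp_mean p n, 0 < gnp_sd p n &
      gnp_sd p n ^+ 2 <= gnp_mean p n], c <= beta p h n,
    [/\ s1 <= gnp_sd p n, s2 <= gnp_sd p n, 1 <= gnp_sd p n & 2 * (K + 1) <= gnp_sd p n] &
    forall d, `|d| <= K * (gnp_sd p n / gnp_mean p n) ->
      `|d| + (h n)%:R / gnp_mean p n <= 2^-1 /\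
      (h n)%:R * (4 * d ^+ 2 + 6 * ((h n)%:R / gnp_mean p n) ^+ 2) +
        (h n)%:R / gnp_mean p n <= c * eps / 2].
have large_near : \forall n \near \oo, large n.
  have := scales _ eta0; apply: filterS => n [a0 s0 sa h3 cb].
  have [] := small _ _ _ a0 s0 sa (ler0n R (h n)) h3 cb.
  rewrite !ge_max => /andP[/andP[? ?] /andP[? ?]] err.
  have cb' : c <= beta p h n by rewrite betaE.
  by split => //; split.
have mO : (fun n => (m n)%:R - p n * nedges R n : R) =O_\oo
         (fun n => Num.sqrt (p n * nedges R n) : R).
  apply/eqO_exP; exists (1 + K); first by lra.
  apply: filterS large_near => n [[a0 s0 sa] _ [_ _ sd1 _] _].
  rewrite -/(gnp_mean p n) (ger0_norm (sqrtr_ge0 _)).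
have := mnear n; rewrite /near_mean => /le_trans; apply.
  have : gnp_sd p n <= Num.sqrt (gnp_mean p n).
    by rewrite -[leLHS]gtr0_norm// -sqrtr_sqr ler_sqrt// ltW.
  nra.
have := hgnm m mN mO theta theta0.
move=> /cvgr_le /(_ _ e0) hm.
near=> n.
have p01 := hp n; have [p0 p1] := andP p01.
have p01' : 0 <= p n <= 1 by rewrite !ltW.
have Prm : Pr (@gnm R n (m n)) (bad n (m n)) <= eps by near: n.
have [[a0 s0 sa] cb [sd1 sd2 _ sdK] err] : large n by near: n.
have b0 : 0 < beta p h n by exact: lt_le_trans cb.
pose x k := standardize (gnp_mean p n) (gnp_sd p n) k.
pose W k := `|x k| <= K.
have xE k : k%:R - gnp_mean p n = x k * gnp_sd p n by rewrite divfK// gt_eqF.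
have Wbad k : (k <= 'C(n, 2))%N -> W k -> Pr (@gnm R n k) (bad n k) <= eps.
  move=> kN Wk; rewrite leNgt; apply/negP => badk.
  have near_k : near_mean n k.
    rewrite /near_mean xE normrM (gtr0_norm s0).
    have := ler_wpM2r (ltW s0) Wk; lra.
  move: Prm; rewrite /m; case: pickP => [j /andP[_ +]|/(_ (Ordinal (kN : (k < _.+1)%N)))].
    by rewrite ltNge => /negP.
  by rewrite /= near_k badk.
have Wclose k (G : graph n) : #|G| = k -> W k -> ~~ bad n k G ->
    exists2 r, log_count p h S G = r%:E & `|r - x k| <= eps.
  move=> Gk Wk; rewrite -leNgt -Gk => Xclose.
  have [|small1 small2] := err ((#|G|%:R - gnp_mean p n) / gnp_mean p n).
    have sa0 : 0 <= gnp_sd p n / gnp_mean p n by rewrite divr_ge0.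
    by rewrite xE Gk -mulrA normrM (ger0_norm sa0) ler_wpM2r.
  have [r rE rx] := log_count_close p01 (hS n) b0 small1 theta1 Xclose.
  exists r => //; rewrite -/(x _) in rx; rewrite -(ler_pM2l c0).
  apply: le_trans (_ : beta p h n * `|r - x #|G| | <= _).
    by rewrite ler_wpM2r.
  by apply: le_trans rx _; lra.
have sdE : gnp_sd p n ^+ 2 = 'C(n, 2)%:R * p n * (1 - p n) := gnp_sd_sqr p01.
have tail : \sum_(k < ('C(n, 2)).+1 | ~~ W k) binomial_pmf 'C(n, 2) (p n) k <= eps.
  apply: le_trans KK; apply: le_trans (binomial_window_compl p01 K1 sdE sdK).
  by under eq_bigl do rewrite -ltNge.
pose A (G : graph n) := (log_count p h S G <= t%:E)%E.
pose b k := binomial_pmf 'C(n, 2) (p n) k.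
(* If x k > t + eps and X is close to its mean then the normalised logarithm
   exceeds t; symmetrically for the complement. *)
have up : Pr (gnp (p n)) A <=
    \sum_(k < ('C(n, 2)).+1 | x k <= t + eps) b k + eps + eps.
  apply: le_trans (_ : _ + \sum_(k < ('C(n, 2)).+1 | ~~ W k) b k + eps <= _).
    apply: (Pr_gnp_le (Q := fun k => x k <= t + eps) p01' (ltW e0)) => k kN.
    rewrite -ltNge => Qk Wk; apply: le_trans (Wbad k kN Wk).
    apply: Pr_gnm_le => G Gk; rewrite /A => LG; apply/negPn/negP.
    move=> /(Wclose k G Gk Wk)[r rE]; move: LG; rewrite rE lee_fin => rt.
    by rewrite ler_norml => /andP[]; lra.
  by rewrite lerD2r lerD2l.
have lo : Pr (gnp (p n)) (predC A) <=
    \sum_(k < ('C(n, 2)).+1 | t - eps < x k) b k + eps + eps.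
  apply: le_trans (_ : _ + \sum_(k < ('C(n, 2)).+1 | ~~ W k) b k + eps <= _).
    apply: (Pr_gnp_le (Q := fun k => t - eps < x k) p01' (ltW e0)) => k kN.
    rewrite -leNgt => Qk Wk; apply: le_trans (Wbad k kN Wk).
    apply: Pr_gnm_le => G Gk; rewrite /A/= => LG; apply/negPn/negP.
    move=> /(Wclose k G Gk Wk)[r rE]; move: LG; rewrite rE lee_fin -ltNge => rt.
    by rewrite ler_norml => /andP[]; lra.
  by rewrite lerD2r lerD2l.
have := Pr_gnp_compl (p n) A.
have := binomial_sum1 'C(n, 2) (p n).
rewrite (bigID (fun k : 'I_('C(n, 2)).+1 => x k <= t - eps))/=.
under [X in _ + X = _]eq_bigl do rewrite -ltNge.
rewrite -/b => tot PrA.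
have := clt1 _ _ _ p01 sdE sd1; have := clt2 _ _ _ p01 sdE sd2.
rewrite -[p n * _]/(gnp_mean p n) -/b -/x !ler_norml => /andP[? ?] /andP[? ?].
have /Phi_lipschitz L1 : t <= t + eps by lra.
have /Phi_lipschitz L2 : t - eps <= t by lra.
have eps4 : eps0 = 4 * eps by rewrite /eps; lra.
by apply/andP; split; rewrite eps4; lra.
Unshelve. all: by end_near. Qed.
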